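(* Let $H$ be a subgroup of $\mathbb{R}^n$. Let $K_n$ be the simplex of positive linear functionals $\tau$ on $\mathbb{R}^n$ with $\tau(1,\dots,1)=1$, whose vertices are the coordinate functionals $\tau_1,\dots,\tau_n$. Let $F$ be the smallest face of $K_n$ containing $Z(H)=\{\tau\in K_n\mid\tau(H)=\{0\}\}$, let $\tau_{i_1},\dots,\tau_{i_\ell}$ be the vertices of $F$, and let $\{\tau_{j_1},\dots,\tau_{j_k}\}$ be a maximal set of vertices of $F$ whose restrictions to $\mathbb{R}H$ are linearly independent over $\mathbb{R}$. Then the following are equivalent: (i) for every $\epsilon>0$ and $h\in H$ there exists $h'\in H$ with all coordinates of $h-2h'$ at least $-\epsilon$ (equivalently, with $2$ replaced by any fixed integer $m>1$); (ii) the group $H'=\{(\tau_{i_1}(h),\dots,\tau_{i_\ell}(h))\mid h\in H\}$ is dense in the real subspace $\mathbb{R}H'$ of $\mathbb{R}^\ell$ that it spans; (iii) the group $H''=\{(\tau_{j_1}(h),\dots,\tau_{j_k}(h))\mid h\in H\}$ is dense in $\mathbb{R}^k$.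
   Context: A face of a convex set $K$ is a subset $F\subseteq K$ such that any line segment in $K$ whose relative interior meets $F$ is contained in $F$. Condition (i) is property (B) for $H$ in $\mathbb{R}^n$ with coordinatewise order and order unit $(1,\dots,1)$; condition (ii) is property (A): for all $\epsilon>0$ and $x\in H'$ there is $x'\in H'$ with $\|x-mx'\|\le\epsilon$, which is equivalent to $H'$ being dense in $\mathbb{R}H'$. *)

(* Defs.v *)
From HB Require Import structures.
From mathcomp Require Import all_boot all_order all_algebra.
From mathcomp Require Import all_classical all_reals all_analysis.

Set Implicit Arguments.
Unset Strict Implicit.
Unset Printing Implicit Defensive.

Import Order.TTheory GRing.Theory Num.Theory.
Import numFieldNormedType.Exports.

Local Open Scope classical_set_scope.
Local Open Scope ring_scope.

Section Convexity.
Context {R : realType} {E : lmodType R}.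

Definition segment (a b : E) : set E :=
  [set (1 - t) *: a + t *: b | t in [set t : R | 0 <= t <= 1]].

(* If a = b this is [set a], which is also the relative interior of the
   degenerate segment. *)
Definition segment_relint (a b : E) : set E :=
  [set (1 - t) *: a + t *: b | t in [set t : R | 0 < t < 1]].

(* Convexity of F is not part of the definition.  The smallest face containing
   a given convex subset of a simplex is convex anyway. *)
Definition face (K F : set E) : Prop :=
  F `<=` K /\
  forall a b : E, segment a b `<=` K ->
    segment_relint a b `&` F !=set0 -> segment a b `<=` F.

Definition vertices (F : set E) : set E := [set p | face F [set p]].

Definition real_span (A : set E) : set E :=
  smallest (fun V : set E => submod_closed (mem V)) A.

End Convexity.

Section Simplex.
Context {R : realType} {n : nat}.

Definition functional := 'Hom('rV[R]_n, R^o).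

Definition positive (f : functional) : Prop :=
  forall x : 'rV[R]_n, (forall i, 0 <= x ord0 i) -> 0 <= f x.

Definition simplex : set functional :=
  [set f | positive f /\ f (const_mx 1) = 1].

Definition tau (i : 'I_n) : functional :=
  linfun (fun x : 'rV[R]_n => x ord0 i : R^o).

Lemma tauE (i : 'I_n) (x : 'rV[R]_n) : tau i x = x ord0 i.
Proof.
pose f (x : 'rV[R]_n) : R^o := x ord0 i.
have fL : linear f by move=> a u v; rewrite /f !mxE.
pose fl := HB.pack_for {linear 'rV[R]_n -> R^o} f
  (GRing.isLinear.Build R _ _ _ f fL).
exact: (lfunE fl x).
Qed.

Definition annihilator (H : set 'rV[R]_n) : set functional :=
  [set f | simplex f /\ forall h, H h -> f h = 0].

Definition min_face (H : set 'rV[R]_n) : set functional :=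
  smallest (face simplex) (annihilator H).

(* The restrictions to V of the tau i, for i in J, are linearly independent as
   a family; in particular two distinct vertices with the same restriction are
   dependent. *)
Definition indep_on (V : set 'rV[R]_n) (J : {set 'I_n}) : Prop :=
  forall c : 'I_n -> R,
    (forall x, V x -> \sum_(i in J) c i * tau i x = 0) ->
    forall i, i \in J -> c i = 0.

Definition indep_vertices (H : set 'rV[R]_n) (J : {set 'I_n}) : Prop :=
  (forall i, i \in J -> vertices (min_face H) (tau i)) /\
  indep_on (real_span H) J.

Definition coord_image l (i : 'I_l -> 'I_n) (H : set 'rV[R]_n) :
    set 'rV[R]_l :=
  [set \row_(a < l) tau (i a) h | h in H].

Definition property_B (m : nat) (H : set 'rV[R]_n) : Prop :=
  forall eps : R, 0 < eps -> forall h, H h ->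
    exists2 h', H h' & forall i, - eps <= (h - m%:R *: h') ord0 i.

End Simplex.

Arguments functional : clear implicits.

Definition dense_in {T : topologicalType} (A B : set T) : Prop :=
  A `<=` B /\ B `<=` closure A.

(* Main.v *)
(* The vertices of the smallest face are the [tau i] with [p_i > 0] for some
   [p] in [Z(H)].  On them (i) implies (ii): a lower bound on the coordinates
   of [h - m h'] gives an upper bound because [p (h - m h') = 0], so the closure
   of [H'] is divisible by [m], hence a real subspace.  Conversely, Farkas'
   lemma provides [v] in the span of [H] that vanishes on the face and is
   positive off it; approximating [h / m] on the face by [h1] in [H], one
   subtracts from [h1] an element of [H] close to a large multiple of [v]
   (simultaneous Diophantine approximation) to make the other coordinates of
   the difference positive.  Finally [H'] and [H''] correspond to each other
   under a linear isomorphism of the spans. *)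

Require Import Defs.
From HB Require Import structures.
From mathcomp Require Import all_boot all_order all_algebra.
From mathcomp Require Import all_classical all_reals all_analysis.
From mathcomp Require Import ring lra.

Set Implicit Arguments.
Unset Strict Implicit.
Unset Printing Implicit Defensive.

Import Order.TTheory GRing.Theory Num.Theory.
Import numFieldNormedType.Exports.

Local Open Scope classical_set_scope.
Local Open Scope ring_scope.

(** * Real subspaces given as sets *)

Section Submodule.
Context {R : pzRingType} {E : lmodType R}.
Implicit Types V : set E.

Lemma mem_submod_closed V : V 0 ->
  (forall a u v, V u -> V v -> V (a *: u + v)) -> submod_closed (mem V).
Proof. by move=> V0 VP; split=> [|a u v]; rewrite !inE//; apply: VP. Qed.

Lemma submod_closedP V (a : R) u v : submod_closed (mem V) ->
  V u -> V v -> V (a *: u + v).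
Proof. by move=> [_ /(_ a u v)]; rewrite !inE => VP Vu Vv; apply: VP. Qed.

Lemma submod_closed_mem0 V : submod_closed (mem V) -> V 0.
Proof. by case=> + _; rewrite inE. Qed.

End Submodule.

(** * Farkas' lemma on a subspace *)

Section Farkas.
Context {R : realFieldType} {E : lmodType R} (V : set E).
Hypothesis V_submod : submod_closed (mem V).

Let V0 : V 0 := submod_closed_mem0 V_submod.

Let VP (a : R) u v : V u -> V v -> V (a *: u + v).
Proof. exact: (submod_closedP a V_submod). Qed.

(** Induction on the list of constraints: a redundant [f i] gets coefficient 0, any other is
    eliminated by a projection. Working relative to [V] allows an application to the span of [H]
    without choosing a basis. *)
Lemma farkas (I : eqType) (s : seq I) (f : I -> E -> R) (g : E -> R) :
  uniq s -> (forall i, scalar (f i)) -> scalar g ->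
  (forall x, V x -> (forall i, i \in s -> f i x <= 0) -> g x <= 0) ->
  exists2 c : I -> R, (forall i, 0 <= c i) &
    forall x, V x -> g x = \sum_(i <- s) c i * f i x.
Proof.
elim: s f g => [|i s IHs] f g.
  move=> _ _ gL g_le0; exists (fun=> 0) => // x Vx; rewrite big_nil.
  (* Without constraints [g] is nonpositive at [x] and at [- 2 *: x + x], which is [- x]; hence it
     vanishes. *)
  have := g_le0 _ Vx (fun _ _ => ltac:(by [])).
  have := g_le0 _ (VP (- 2) Vx Vx) (fun _ _ => ltac:(by [])).
  by rewrite gL; lra.
move=> /= /andP[i_s s_uniq] fL gL g_le0.
have [g_le0'|] := pselect (forall x, V x ->
    (forall i0, i0 \in s -> f i0 x <= 0) -> g x <= 0).
  have [c c_ge0 cE] := IHs f g s_uniq fL gL g_le0'.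
  exists (fun i0 => if i0 == i then 0 else c i0) => [i0|x Vx].
    by case: ifP.
  rewrite big_cons eqxx mul0r add0r cE// !big_seq; apply: eq_bigr => i0 i0s.
  by case: eqP => // i0i; rewrite -i0i i0s in i_s.
(* Bartl's elimination step: project along a point where [g] is positive,
   which the constraint [f i] alone excludes. *)
move=> /existsNP[x0 /not_implyP[Vx0 /not_implyP[fx0 gx0]]].
have {}gx0 : 0 < g x0 by rewrite ltNge; apply/negP.
have fix0 : 0 < f i x0.
  rewrite ltNge; apply/negP => fix0; have := g_le0 x0 Vx0.
  rewrite leNgt gx0 => /(_ _)/negP; case=> // i0.
  by rewrite inE => /predU1P[->//|/fx0].
pose x1 := (f i x0)^-1 *: x0.
have fi0 i0 : f i0 0 = 0.
  by have := fL i0 (-1) 0 0; rewrite scaler0 addr0; lra.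
have g0 : g 0 = 0 by have := gL (-1) 0 0; rewrite scaler0 addr0; lra.
have fZ i0 a x : f i0 (a *: x) = a * f i0 x.
  by have := fL i0 a x 0; rewrite addr0 fi0 addr0.
have gZ a x : g (a *: x) = a * g x.
  by have := gL a x 0; rewrite addr0 g0 addr0.
have Vx1 : V x1 by rewrite /x1 -[_ *: _]addr0; apply: VP.
have fix1 : f i x1 = 1 by rewrite /x1 fZ mulVf// gt_eqF.
have gx1 : 0 < g x1 by rewrite /x1 gZ mulr_gt0// invr_gt0.
have fx1 i0 : i0 \in s -> f i0 x1 <= 0.
  by move=> i0s; rewrite /x1 fZ pmulr_rle0 ?invr_gt0//; apply: fx0.
(* These are the values of [f i0] and [g] at [x - f i x *: x1], the projection of [x] along [x1] to
   the kernel of [f i]. *)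
pose f' i0 x := f i0 x - f i x * f i0 x1.
pose g' x := g x - f i x * g x1.
have f'L i0 : scalar (f' i0) by move=> a u v; rewrite /f' !fL; lra.
have g'L : scalar g' by move=> a u v; rewrite /g' !fL gL; lra.
have [x Vx f'x|c c_ge0 cE] := IHs f' g' s_uniq f'L g'L.
  have := g_le0 _ (VP (- f i x) Vx1 Vx); rewrite gL /g' => H.
  suff : - f i x * g x1 + g x <= 0 by lra.
  apply: H => i0; rewrite inE fL => /predU1P[->|/f'x].
    by rewrite fix1; lra.
  by rewrite /f'; lra.
(* The coefficient of [f i x] once the identity for [g'] is expanded; it is nonnegative because
   [g x1 > 0] and each [f i0 x1 <= 0]. *)
pose b := g x1 - \sum_(i0 <- s) c i0 * f i0 x1.
exists (fun i0 => if i0 == i then b else c i0) => [i0|x Vx].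
  case: ifP => // _; rewrite /b subr_ge0 (le_trans _ (ltW gx1))// big_seq.
  by apply: sumr_le0 => i1 i1s; rewrite mulr_ge0_le0// fx1.
rewrite big_cons eqxx.
transitivity (b * f i x + \sum_(i0 <- s) c i0 * f i0 x); last first.
  congr (_ + _); rewrite !big_seq; apply: eq_bigr => i0 i0s.
  by case: eqP => // i0i; rewrite -i0i i0s in i_s.
have := cE x Vx; rewrite /g' /b => /eqP; rewrite subr_eq => /eqP ->.
under eq_bigr do rewrite /f' mulrBr mulrCA.
rewrite sumrB -mulr_sumr.
lra.
Qed.

(** Each equation [f i x = 0] is a pair of inequalities, indexed by a sign in [bool]; Farkas' lemma
    applies, and the two coefficients are subtracted. *)
Lemma scalar_combination (I : finType) (f : I -> E -> R) (g : E -> R) :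
  (forall i, scalar (f i)) -> scalar g ->
  (forall x, V x -> (forall i, f i x = 0) -> g x = 0) ->
  exists c : I -> R, forall x, V x -> g x = \sum_i c i * f i x.
Proof.
move=> fL gL g0.
pose f' (q : bool * I) x := (-1) ^+ q.1 * f q.2 x.
have f'L q : scalar (f' q) by move=> a u v; rewrite /f' fL mulrDr mulrCA.
have [x Vx f'x|c c_ge0 cE] := farkas (index_enum_uniq _) f'L gL.
  rewrite g0// => i; apply/eqP; rewrite eq_le.
  have := f'x (false, i) (mem_index_enum _).
  have := f'x (true, i) (mem_index_enum _).
  by rewrite /f' /= expr0 expr1; lra.
exists (fun i => c (false, i) - c (true, i)) => x Vx.
rewrite cE//.
transitivity (\sum_(q : bool * I) c (q.1, q.2) * f' (q.1, q.2) x).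
  by apply: eq_bigr => -[].
rewrite -(pair_bigA _ (fun b i => c (b, i) * f' (b, i) x)) /=.
rewrite big_bool /= -big_split /=; apply: eq_bigr => i _.
by rewrite /f' /= expr0 expr1; lra.
Qed.

End Farkas.

(** * Simultaneous Diophantine approximation *)

(* Pigeonhole on the fractional parts of the multiples [t * N0 * c]. *)
Lemma dirichlet (R : realType) (r : nat) (c : 'I_r -> R) (N0 : nat)
    (eps : R) : 0 < eps ->
  exists2 N, (N0 <= N)%N & exists z : 'I_r -> int,
    forall a, `|N%:R * c a - (z a)%:~R| < eps.
Proof.
move=> eps_gt0.
(* The unit cube is cut into cells of side [Q^-1 < eps]. *)
pose Q := (Num.truncn eps^-1).+1.
have Q_gt0 : 0 < Q%:R :> R by rewrite ltr0n.
have Qeps : Q%:R^-1 < eps.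
  by rewrite -[eps]invrK ltf_pV2 ?posrE ?invr_gt0// truncnS_gt.
(* With the factor [N0.+1], the difference of two distinct multipliers is at least [N0]. *)
pose u (t : nat) a : R := (t * N0.+1)%:R * c a.
pose frac (x : R) := x - (Num.floor x)%:~R.
have frac01 x : 0 <= frac x < 1.
  by have := floor_itv x; rewrite intrD /frac; lra.
have Qfrac_ge0 x : 0 <= Q%:R * frac x.
  by rewrite mulr_ge0//; case/andP: (frac01 x).
have cell_lt x : (Num.truncn (Q%:R * frac x) < Q)%N.
  rewrite truncn_lt_nat// -[ltRHS]mulr1 ltr_pM2l//.
  by case/andP: (frac01 x).
(* There is one more value of [t] than there are cells. *)
pose cell (t : 'I_(#|{ffun 'I_r -> 'I_Q}|.+1)) : {ffun 'I_r -> 'I_Q} :=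
  [ffun a => Ordinal (cell_lt (u t a))].
have /injectivePn[t1 [t2 t12 cell12]] : ~~ injectiveb cell.
  by apply/negP => /injectiveP/leq_card; rewrite card_ord ltnn.
wlog t_lt : t1 t2 t12 cell12 / (t1 < t2)%N.
  move=> wlog_lt; have [|t21|/val_inj t12'] := ltngtP t1 t2.
  - exact: wlog_lt.
  - by apply: (wlog_lt t2 t1) => //; rewrite eq_sym.
  - by rewrite t12' eqxx in t12.
exists ((t2 - t1) * N0.+1)%N.
  by rewrite (leq_trans (leqnSn _))// leq_pmull// subn_gt0.
exists (fun a => Num.floor (u t2 a) - Num.floor (u t1 a)) => a.
have -> : ((t2 - t1) * N0.+1)%:R * c a = u t2 a - u t1 a.
  by rewrite /u -mulrBl -natrB ?mulnBl// leq_mul2r ltnW ?orbT.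
rewrite intrB.
have -> : u t2 a - u t1 a - ((Num.floor (u t2 a))%:~R -
    (Num.floor (u t1 a))%:~R) = frac (u t2 a) - frac (u t1 a).
  by rewrite /frac; lra.
apply: le_lt_trans Qeps; rewrite -[leRHS]mul1r ler_pdivlMr//.
rewrite -[Q%:R]gtr0_norm// -normrM mulrBl ![_ * Q%:R]mulrC.
have := truncn_itv (Qfrac_ge0 (u t2 a)).
have := truncn_itv (Qfrac_ge0 (u t1 a)).
have := congr1 (fun h : {ffun _} => nat_of_ord (h a)) cell12.
rewrite /cell !ffunE /= => ->; rewrite -natr1 ler_norml; lra.
Qed.

(** * Real spans and linear images *)

Section Span.
Context {R : realType} {E : lmodType R}.
Implicit Types A V : set E.

Lemma sub_real_span A : A `<=` real_span A.
Proof. exact: sub_smallest. Qed.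

Lemma real_span_min A V : submod_closed (mem V) -> A `<=` V ->
  real_span A `<=` V.
Proof. exact: smallest_sub. Qed.

Lemma real_span_submod A : submod_closed (mem (real_span A)).
Proof.
apply: mem_submod_closed => [V [V_submod _]|a u v Au Av V [V_submod AV]].
  exact: submod_closed_mem0.
have sAV := real_span_min V_submod AV.
by apply: (submod_closedP a V_submod); exact: sAV.
Qed.

Lemma real_span0 A : real_span A 0.
Proof. exact: (submod_closed_mem0 (real_span_submod A)). Qed.

Lemma real_spanP A (a : R) u v : real_span A u -> real_span A v ->
  real_span A (a *: u + v).
Proof. by move=> Au Av; apply: (submod_closedP _ (real_span_submod A)). Qed.

Lemma real_spanZ A (a : R) u : real_span A u -> real_span A (a *: u).
Proof.
move=> Au; rewrite -[_ *: _]addr0; apply: real_spanP => //.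
exact: real_span0.
Qed.

Lemma real_spanD A u v : real_span A u -> real_span A v ->
  real_span A (u + v).
Proof. by move=> Au Av; rewrite -[u]scale1r; apply: real_spanP. Qed.

Lemma real_span_sum A (I : finType) (P : pred I) (F : I -> E) :
  (forall i, P i -> real_span A (F i)) ->
  real_span A (\sum_(i | P i) F i).
Proof.
move=> AF; apply: (big_ind (real_span A)) => //; last exact: real_spanD.
exact: real_span0.
Qed.

Lemma real_span_combination A v : real_span A v ->
  exists r (c : 'I_r -> R) (x : 'I_r -> E),
    (forall a, A (x a)) /\ v = \sum_a c a *: x a.
Proof.
pose V : set E := [set v | exists r (c : 'I_r -> R) (x : 'I_r -> E),
    (forall a, A (x a)) /\ v = \sum_a c a *: x a].
suff [V_submod AV] : submod_closed (mem V) /\ A `<=` V.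
  exact: (real_span_min V_submod AV).
split; last first.
  by move=> x Ax; exists 1%N, (fun=> 1), (fun=> x); rewrite big_ord1 scale1r.
apply: mem_submod_closed => [|b u w].
  by exists 0%N, (fun=> 0), (fun=> 0); rewrite big_ord0; split=> // -[].
move=> [r [c [x [Ax ->]]]] [s [d [y [Ay ->]]]].
exists (r + s)%N,
  (fun a => match fintype.split a with inl a => b * c a | inr a => d a end),
  (fun a => match fintype.split a with inl a => x a | inr a => y a end); split.
  by move=> a; case: fintype.split.
rewrite big_split_ord /= scaler_sumr; congr (_ + _); apply: eq_bigr => a _.
  by rewrite (fintype.unsplitK (inl a)) scalerA.
by rewrite (fintype.unsplitK (inr a)).
Qed.

End Span.

(** Both inclusions follow from minimality of the span: the image of a subspace is a subspace, and
    so is the preimage. *)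
Lemma real_span_image (R : realType) (E F : lmodType R)
    (f : {linear E -> F}) (A : set E) :
  real_span (f @` A) = f @` real_span A.
Proof.
apply/seteqP; split.
  apply: real_span_min; last by apply: image_subset; exact: sub_real_span.
  apply: mem_submod_closed => [|a _ _ [u Au <-] [v Av <-]].
    by exists 0; [exact: real_span0|exact: linear0].
  exists (a *: u + v); last exact: linearP.
  exact: real_spanP.
move=> _ [x Ax <-]; pose V : set E := [set x | real_span (f @` A) (f x)].
suff [V_submod AV] : submod_closed (mem V) /\ A `<=` V.
  exact: (real_span_min V_submod AV).
split; last by move=> y Ay; apply: sub_real_span; exists y.
apply: mem_submod_closed => [|a u v Vu Vv]; rewrite /V /=.
  by rewrite linear0; exact: real_span0.
by rewrite linearP; exact: real_spanP.
Qed.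

(** * Subgroups and approximation of multiples of vectors in their span *)

Section Subgroup.
Context {U : zmodType} (A : set U).
Hypothesis A_subgroup : zmod_closed (mem A).

Lemma subgroup0 : A 0.
Proof. by have [+ _] := A_subgroup; rewrite inE. Qed.

Lemma subgroupB x y : A x -> A y -> A (x - y).
Proof.
by have [_ /(_ x y)] := A_subgroup; rewrite !inE => AB Ax Ay; apply: AB.
Qed.

Lemma subgroupN x : A x -> A (- x).
Proof.
by move=> Ax; rewrite -sub0r; apply: subgroupB => //; exact: subgroup0.
Qed.

Lemma subgroupD x y : A x -> A y -> A (x + y).
Proof. by move=> Ax Ay; rewrite -[y]opprK; apply/subgroupB/subgroupN. Qed.

Lemma subgroupMz x (z : int) : A x -> A (x *~ z).
Proof.
move=> Ax; have AMn k : A (x *+ k).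
  by elim: k => [|k Ak]; [exact: subgroup0|rewrite mulrS; exact: subgroupD].
by case: z => k; [exact: AMn|exact/subgroupN/AMn].
Qed.

Lemma subgroup_sum (I : finType) (F : I -> U) : (forall i, A (F i)) ->
  A (\sum_i F i).
Proof.
by move=> AF; apply: (big_ind A) => //; [exact: subgroup0|exact: subgroupD].
Qed.

End Subgroup.

(** Write [v] as a combination of elements of [H]; rounding the coefficients of a suitable multiple
    [N *: v] to integers gives an element of [H]. *)
Lemma recurrence (R : realType) (n : nat) (H : set 'rV[R]_n) v (N0 : nat)
    (eps : R) : zmod_closed (mem H) -> real_span H v -> 0 < eps ->
  exists2 N, (N0 <= N)%N & exists2 h, H h &
    forall i, `|N%:R * v ord0 i - h ord0 i| < eps.
Proof.
move=> H_subgroup /real_span_combination[r [c [x [Hx ->]]]] eps_gt0.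
(* [C] strictly exceeds the sum over [a] of [|x a ord0 i|] for every [i], so coefficient errors
   below [eps / C] suffice. *)
pose C := 1 + \sum_a \sum_i `|x a ord0 i|.
have C_gt0 : 0 < C by rewrite ltr_pwDl// !sumr_ge0// => a _; rewrite sumr_ge0.
have [N N0N [z zE]] := dirichlet c N0 (divr_gt0 eps_gt0 C_gt0).
exists N => //; exists (\sum_a x a *~ z a).
  by apply: subgroup_sum => // a; apply: subgroupMz.
move=> i; rewrite !summxE mulr_sumr -sumrB.
apply: (le_lt_trans (ler_norm_sum _ _ _)).
apply: (@le_lt_trans _ _ (\sum_a eps / C * `|x a ord0 i|)).
  apply: ler_sum => a _; rewrite mxE.
  have -> : (x a *~ z a) ord0 i = (z a)%:~R * x a ord0 i.
    by rewrite -scaler_int mxE.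
  by rewrite mulrA -mulrBl normrM ler_wpM2r// ltW.
rewrite -mulr_sumr mulrAC ltr_pdivrMr// ltr_pM2l//.
rewrite /C ltr_pwDl// ler_sum// => a _.
by rewrite (bigD1 i)//= lerDl sumr_ge0.
Qed.

Lemma dense_closureP (T : topologicalType) (B : set T) :
  dense B <-> forall y, closure B y.
Proof.
split=> [B_dense y|clB].
  move=> N; rewrite nbhsE => -[W [W_open Wy] WN].
  have [z [Wz Bz]] := B_dense W (ex_intro _ y Wy) W_open.
  by exists z; split=> //; exact: WN.
move=> W [y Wy] W_open.
have [z [Bz Wz]] := clB y W (open_nbhs_nbhs (conj W_open Wy)).
by exists z.
Qed.

(** * Closures of subgroups of row vectors *)

Section RowClosure.
Context {R : realType} {l : nat}.
Implicit Types (A : set 'rV[R]_l) (x : 'rV[R]_l).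

Lemma closure_rowP A x : closure A x <->
  forall e : R, 0 < e ->
    exists2 y, A y & forall a, `|x ord0 a - y ord0 a| < e.
Proof.
split=> [Ax e e_gt0|xA B /nbhs_ballP[e /= e_gt0 xeB]].
  have [y [Ay xy]] := Ax _ (nbhsx_ballx x e e_gt0).
  by exists y => // a; exact: (xy.2 ord0 a).
have [y Ay xy] := xA e e_gt0; exists y; split=> //.
by apply: xeB; split=> // a b; rewrite (ord1 a); exact: xy.
Qed.

Lemma closure_subgroup A : zmod_closed (mem A) ->
  zmod_closed (mem (closure A)).
Proof.
move=> A_subgroup; split=> [|x y]; rewrite !inE.
  by apply: subset_closure; exact: subgroup0.
move=> /closure_rowP Ax /closure_rowP Ay; apply/closure_rowP => e e_gt0.
have [x' Ax' xx'] := Ax _ (divr_gt0 e_gt0 (ltr0n R 2)).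
have [y' Ay' yy'] := Ay _ (divr_gt0 e_gt0 (ltr0n R 2)).
exists (x' - y'); first exact: subgroupB.
by move=> a; have := xx' a; have := yy' a; rewrite !mxE !ltr_norml; lra.
Qed.

(* The closure is divisible by [m], hence stable under [Z[1/m]], which is
   dense in [R]. *)
Lemma closure_divisible_submod A (m : nat) : (1 < m)%N ->
  zmod_closed (mem A) ->
  (forall e : R, 0 < e -> forall x, A x ->
     exists2 y, A y & forall a, `|x ord0 a - m%:R * y ord0 a| < e) ->
  submod_closed (mem (closure A)).
Proof.
move=> m_gt1 A_subgroup A_div.
have cA_subgroup := closure_subgroup A_subgroup.
have m1 : 1 < m%:R :> R by rewrite ltr1n.
have m0 : 0 < m%:R :> R by apply: lt_trans m1.
have cA_div x : closure A x -> closure A (m%:R^-1 *: x).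
  move=> /closure_rowP Ax; apply/closure_rowP => e e_gt0.
  have [y Ay xy] := Ax _ (divr_gt0 e_gt0 (ltr0n R 2)).
  have [z Az yz] := A_div _ (divr_gt0 e_gt0 (ltr0n R 2)) _ Ay.
  exists z => // a; rewrite mxE.
  have -> : m%:R^-1 * x ord0 a - z ord0 a =
            m%:R^-1 * (x ord0 a - m%:R * z ord0 a).
    by rewrite mulrBr mulKf ?gt_eqF.
  rewrite normrM gtr0_norm ?invr_gt0// mulrC ltr_pdivrMr//.
  have : e <= e * m%:R by rewrite ler_peMr// ltW.
  by have := xy a; have := yz a; rewrite !ltr_norml; lra.
have cA_divX k x : closure A x -> closure A ((m%:R ^+ k)^-1 *: x).
  move=> Ax; elim: k => [|k IHk]; first by rewrite expr0 invr1 scale1r.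
  by rewrite exprS invfM -scalerA; apply: cA_div.
have cAZ t x : closure A x -> closure A (t *: x).
  move=> Ax; apply/closure_rowP => e e_gt0.
  pose M := 1 + \sum_a `|x ord0 a|.
  have xM a : `|x ord0 a| < M.
    by rewrite /M (bigD1 a)//= addrCA ltrDl ltr_pwDl// sumr_ge0.
  have M_gt0 : 0 < M by rewrite ltr_pwDl// sumr_ge0.
  (* Since [m ^ k > k], the denominator [b] exceeds [2 * M / e]. *)
  pose k := (Num.truncn (2 * M / e)).+1; pose b : R := m%:R ^+ k.
  have b_gt0 : 0 < b by rewrite exprn_gt0.
  have bM : b^-1 * M < e / 2.
    rewrite mulrC ltr_pdivrMr// -ltr_pdivrMl; last by lra.
    rewrite invf_div mulrAC; apply: (lt_le_trans (truncnS_gt _)).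
    by rewrite /b -natrX ler_nat ltnW// ltn_expl.
  (* The fraction [z / b] lies within [b^-1] of [t], which moves each coordinate of [t *: x] by less
     than [e / 2]. *)
  pose z := Num.floor (t * b).
  have := subgroupMz cA_subgroup z (cA_divX k _ Ax); rewrite -scaler_int.
  move=> /closure_rowP/(_ _ (divr_gt0 e_gt0 (ltr0n R 2)))[y Ay xy].
  exists y => // a.
  have tz : `|t * x ord0 a - z%:~R * (b^-1 * x ord0 a)| < e / 2.
    have -> : t * x ord0 a - z%:~R * (b^-1 * x ord0 a) =
              (t * b - z%:~R) * (b^-1 * x ord0 a).
      by rewrite mulrBl [in RHS]mulrA mulfK ?gt_eqF.
    apply: le_lt_trans bM.
    rewrite normrM -[leRHS]mul1r ler_pM//.
      by have := floor_itv (t * b); rewrite -/z intrD ler_norml; lra.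
    by rewrite normrM gtr0_norm ?invr_gt0// ler_pM2l ?invr_gt0// ltW.
  by have := xy a; move: tz; rewrite !mxE -/b !ltr_norml; lra.
apply: mem_submod_closed => [|t x y Ax Ay]; first exact: subgroup0.
exact: (subgroupD cA_subgroup (cAZ t x Ax) Ay).
Qed.

End RowClosure.

(** * Faces of the simplex and their vertices *)

Section SimplexFaces.
Context {R : realType} {n : nat}.
Implicit Types (f p : functional R n) (H : set 'rV[R]_n) (i : 'I_n).

Local Notation "''e_' i" := (delta_mx ord0 i : 'rV[R]_n)
  (at level 8, i at level 2, format "''e_' i").

Lemma functionalE f (x : 'rV[R]_n) : f x = \sum_i x ord0 i * f 'e_i.
Proof.
rewrite [in LHS](row_sum_delta x) linear_sum; apply: eq_bigr => i _.
by rewrite linearZ.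
Qed.

Lemma functional_eq f p : (forall i, f 'e_i = p 'e_i) -> f = p.
Proof.
move=> fp; apply/lfunP => x; rewrite !functionalE.
by apply: eq_bigr => i _; rewrite fp.
Qed.

Lemma tau_delta i k : tau i 'e_k = (i == k)%:R :> R.
Proof. by rewrite tauE mxE eqxx. Qed.

(** The values on the standard basis are the barycentric coordinates of [f]. *)
Lemma simplexP f : simplex f <->
  (forall i, 0 <= f 'e_i) /\ \sum_i f 'e_i = 1.
Proof.
rewrite /simplex /=.
have -> : f (const_mx 1) = \sum_i f 'e_i.
  by rewrite functionalE; apply: eq_bigr => i _; rewrite mxE mul1r.
split=> -[f_pos f1]; split=> //.
  by move=> i; apply: f_pos => k; rewrite mxE ler0n.
by move=> x x_ge0; rewrite functionalE sumr_ge0// => i _; rewrite mulr_ge0.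
Qed.

Lemma simplex_tau i : simplex (tau i : functional R n).
Proof.
apply/simplexP; split=> [k|]; first by rewrite tau_delta ler0n.
rewrite (bigD1 i)//= tau_delta eqxx big1 ?addr0// => k.
by rewrite tau_delta eq_sym => /negPf->.
Qed.

Lemma simplex_tauP f i : simplex f ->
  (forall k, k != i -> f 'e_k = 0) -> f = tau i.
Proof.
move=> /simplexP[_ f1] f0; apply: functional_eq => k; rewrite tau_delta.
have [<-|ik] := eqVneq i k; last by rewrite f0// eq_sym.
by rewrite -f1 (bigD1 i)//= big1 ?addr0.
Qed.

Lemma functional_combE (a b : functional R n) (t : R) x :
  ((1 - t) *: a + t *: b) x = (1 - t) * a x + t * b x.
Proof. by rewrite add_lfunE !scale_lfunE. Qed.

Lemma simplex_convex (a b : functional R n) :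
  simplex a -> simplex b -> segment a b `<=` simplex.
Proof.
move=> /simplexP[a_ge0 a1] /simplexP[b_ge0 b1] _ [t /= t01 <-].
apply/simplexP; split=> [i|].
  rewrite functional_combE; have := a_ge0 i; have := b_ge0 i.
  by move=> ? ?; apply: addr_ge0; apply: mulr_ge0 => //; lra.
under eq_bigr do rewrite functional_combE.
by rewrite big_split /= -!mulr_sumr a1 b1; lra.
Qed.

Lemma segmentl (a b : functional R n) : segment a b a.
Proof. by exists 0; rewrite /= ?lexx ?ler01// subr0 scale1r scale0r addr0. Qed.

Lemma segmentr (a b : functional R n) : segment a b b.
Proof. by exists 1; rewrite /= ?lexx ?ler01// subrr scale1r scale0r add0r. Qed.

(** Unless [p] is itself [tau i], it lies strictly between [tau i] and the point [q] of the simplex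
    obtained by removing the weight [t] of [tau i] and rescaling; the face property then yields
    [tau i]. *)
Lemma face_tau (F : set (functional R n)) p i :
  face simplex F -> F p -> 0 < p 'e_i -> F (tau i).
Proof.
move=> [FK F_face] Fp pi_gt0; have Kp := FK _ Fp.
have /simplexP[p_ge0 p1] := Kp.
pose t : R := p 'e_i.
have sum_others : \sum_(k | k != i) p 'e_k = 1 - t.
  by rewrite -p1 [in RHS](bigD1 i)//= /t addrAC subrr add0r.
have [t1|t1] := eqVneq t 1.
  suff <- : p = tau i by [].
  apply: simplex_tauP => // k ki; apply/eqP; rewrite eq_le p_ge0 andbT.
  have <- : \sum_(k | k != i) p 'e_k = 0 by rewrite sum_others t1 subrr.
  by rewrite (bigD1 k)//= lerDl sumr_ge0.
have t_lt1 : t < 1.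
  rewrite lt_neqAle t1 -subr_ge0 -sum_others sumr_ge0//.
pose q := (1 - t)^-1 *: (p - t *: tau i).
have qE k : q 'e_k = (1 - t)^-1 * (p 'e_k - t * (i == k)%:R).
  by rewrite /q scale_lfunE add_lfunE opp_lfunE scale_lfunE tau_delta.
have Kq : simplex q.
  apply/simplexP; split=> [k|].
    rewrite qE; apply: mulr_ge0; first by rewrite invr_ge0 subr_ge0 ltW.
    by move: (p_ge0 k); rewrite /t; have [<-|_] := eqVneq i k => /=; lra.
  under eq_bigr do rewrite qE.
  rewrite -mulr_sumr sumrB p1 -mulr_sumr (bigD1 i)//= eqxx big1 => [|k].
    by rewrite addr0 mulr1 mulVf// subr_eq0 eq_sym.
  by rewrite eq_sym => /negPf->.
apply: (F_face q (tau i)); last exact: segmentr.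
  exact/simplex_convex/simplex_tau.
exists p; split=> //; exists t; first by rewrite /= pi_gt0.
by rewrite /q scalerA divff ?subr_eq0 1?eq_sym// scale1r subrK.
Qed.

(** These turn out to be exactly the indices of the vertices of [min_face H]. *)
Definition face_support H i := exists2 p, annihilator H p & 0 < p 'e_i.

(** A relative interior point of a segment in the simplex is positive wherever an endpoint is, so
    its support contains that of every point of the segment. *)
Lemma support_face H :
  face simplex [set f | simplex f /\ forall i, 0 < f 'e_i -> face_support H i].
Proof.
split=> [f [] //|a b abK [_ [[t /= t01 <-] [_ ab_supp]]] f ab_f].
split=> [|i]; first exact: abK.
have /simplexP[a_ge0 _] := abK _ (segmentl a b).
have /simplexP[b_ge0 _] := abK _ (segmentr a b).
case: ab_f => s /= s01 <-; rewrite functional_combE => sab_gt0.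
apply: ab_supp; rewrite functional_combE lt_neqAle.
rewrite addr_ge0 ?mulr_ge0//; [|lra|lra].
rewrite andbT eq_sym paddr_eq0 ?mulr_ge0//; [|lra|lra].
apply/negP => /andP[]; rewrite !mulf_eq0.
have /negPf-> : 1 - t != 0 by rewrite gt_eqF//; lra.
have /negPf-> : t != 0 by rewrite gt_eqF//; lra.
by move=> /= /eqP a0 /eqP b0; rewrite a0 b0 !mulr0 addr0 ltxx in sab_gt0.
Qed.

Lemma min_face_sub_simplex H : min_face H `<=` simplex.
Proof. by apply: smallest_sub; [split|move=> f []]. Qed.

(** Forwards, [min_face H] is contained in the face given by [support_face]. Backwards, [face_tau]
    puts [tau i] in every face containing [annihilator H], and [tau i] is an extreme point of the
    simplex. *)
Lemma min_face_vertexP H i :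
  vertices (min_face H) (tau i) <-> face_support H i.
Proof.
split=> [[/(_ _ erefl) Fi _]|[p Zp pi_gt0]].
  pose F : set (functional R n) :=
    [set f | simplex f /\ forall i, 0 < f 'e_i -> face_support H i].
  have ZF : annihilator H `<=` F.
    by move=> p Zp; split=> [|k pk_gt0]; [case: Zp|exists p].
  have [_] := smallest_sub (support_face H) ZF Fi.
  by apply; rewrite tau_delta eqxx.
have Fi : min_face H (tau i).
  by move=> F [F_face ZF]; apply: (face_tau F_face (ZF _ Zp)).
split=> [f /= ->//|a b abF [_ [[t /= t01 <-] /= abE]]].
have Ka : simplex a := min_face_sub_simplex (abF _ (segmentl a b)).
have Kb : simplex b := min_face_sub_simplex (abF _ (segmentr a b)).
have ab0 k : k != i -> (a 'e_k == 0) && (b 'e_k == 0).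
  have /simplexP[a_ge0 _] := Ka; have /simplexP[b_ge0 _] := Kb.
  rewrite eq_sym => /negPf ik.
  have /eqP := congr1 (fun f : functional R n => f 'e_k) abE.
  have ta_ge0 : 0 <= (1 - t) * a 'e_k by apply: mulr_ge0 => //; lra.
  have tb_ge0 : 0 <= t * b 'e_k by apply: mulr_ge0 => //; lra.
  rewrite functional_combE tau_delta ik paddr_eq0//.
  rewrite !mulf_eq0.
  have /negPf-> : 1 - t != 0 by rewrite gt_eqF//; lra.
  by have /negPf-> : t != 0 by rewrite gt_eqF//; lra.
have -> : a = tau i.
  by apply: simplex_tauP => // k /ab0/andP[/eqP].
have -> : b = tau i.
  by apply: simplex_tauP => // k /ab0/andP[_ /eqP].
by move=> _ [s _ <-] /=; rewrite -scalerDl subrK scale1r.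
Qed.
End SimplexFaces.

(** * Nonnegative vectors in the span of [H] *)

Section Cone.
Context {R : realType} {n : nat} (H : set 'rV[R]_n).

Lemma coord_scalar (i : 'I_n) : scalar (fun x : 'rV[R]_n => x ord0 i).
Proof. by move=> a u v; rewrite !mxE. Qed.

Lemma annihilator_span (p : functional R n) v :
  annihilator H p -> real_span H v -> p v = 0.
Proof.
move=> [_ pH] Hv; pose V : set 'rV[R]_n := [set v | p v = 0].
suff V_submod : submod_closed (mem V) by apply: (real_span_min V_submod pH).
apply: mem_submod_closed => [|a u w]; rewrite /V /= ?linear0// => pu pw.
by rewrite linearP /= pu pw scaler0 addr0.
Qed.

(** If there were no such [v], Farkas' lemma would give [x_i = - \sum_k c_k x_k] on the span with
    [c >= 0]. The functional with weights [c], increased by 1 at [i] and normalised by [W], would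
    then kill [H] and be positive at [i]. *)
Lemma off_support_positive (i : 'I_n) : ~ face_support H i ->
  exists2 v, real_span H v & (forall k, 0 <= v ord0 k) /\ 0 < v ord0 i.
Proof.
move=> Si; apply: contrapT => no_v; apply: Si.
pose f k (x : 'rV[R]_n) := - x ord0 k.
have fL k : scalar (f k) by move=> a u v; rewrite /f !mxE opprD mulrN.
have [x Vx fx|c c_ge0 cE] :=
    farkas (real_span_submod H) (index_enum_uniq 'I_n) fL (coord_scalar i).
  rewrite leNgt; apply/negP => xi_gt0; apply: no_v; exists x => //.
  split=> // k.
  by have := fx k (mem_index_enum k); rewrite /f oppr_le0.
pose W := 1 + \sum_k c k.
have W_gt0 : 0 < W by rewrite ltr_pwDl// sumr_ge0.
pose w k := ((i == k)%:R + c k) / W.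
pose p : functional R n := \sum_k w k *: tau k.
have pE x : p x = \sum_k w k * x ord0 k.
  by rewrite sum_lfunE; apply: eq_bigr => k _; rewrite scale_lfunE tauE.
have sum_delta (x : 'I_n -> R) : \sum_k (i == k)%:R * x k = x i.
  rewrite (bigD1 i)//= eqxx mul1r big1 ?addr0// => k.
  by rewrite eq_sym => /negPf->; rewrite mul0r.
have p_delta k : p (delta_mx ord0 k) = w k.
  rewrite pE (bigD1 k)//= mxE !eqxx mulr1 big1 ?addr0// => k' k'k.
  by rewrite mxE eqxx (negPf k'k) mulr0.
exists p; last by rewrite p_delta divr_gt0// eqxx ltr_pwDl.
split=> [|h Hh].
  apply/simplexP; split=> [k|].
    by rewrite p_delta; apply: divr_ge0; [exact: addr_ge0|exact: ltW].
  under eq_bigr do rewrite p_delta.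
  rewrite -mulr_suml big_split /=.
  under eq_bigr do rewrite -[_%:R]mulr1.
  by rewrite (sum_delta (fun=> 1)) divff// gt_eqF.
rewrite pE; under eq_bigr do rewrite /w mulrAC mulrDl.
rewrite -mulr_suml big_split /= sum_delta (cE _ (sub_real_span Hh)).
rewrite -big_split /= big1 ?mul0r// => k _.
by rewrite /f mulrN addNr.
Qed.

(** Sum the vectors of [off_support_positive] over all indices. On the face the sum vanishes, since
    some [p] in [annihilator H] with positive weight there sends this nonnegative vector to 0. *)
Lemma strict_complement :
  exists2 v, real_span H v &
    forall i, (face_support H i -> v ord0 i = 0) /\
              (~ face_support H i -> 0 < v ord0 i).
Proof.
have /choice[v vP] : forall i, exists v, real_span H v /\
    (forall k, 0 <= v ord0 k) /\ (~ face_support H i -> 0 < v ord0 i).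
  move=> i; have [Si|/off_support_positive[v Hv [v_ge0 vi_gt0]]] :=
      pselect (face_support H i); last by exists v.
  by exists 0; split; [exact: real_span0|split=> // k; rewrite mxE].
have sum_ge0 k (P : pred 'I_n) : 0 <= \sum_(i | P i) v i ord0 k.
  by apply: sumr_ge0 => i _; have [_ []] := vP i.
have Hv : real_span H (\sum_i v i).
  by apply: real_span_sum => i _; have [] := vP i.
exists (\sum_i v i) => // i; split=> [[p Zp pi_gt0]|Si]; last first.
  rewrite summxE (bigD1 i)//= ltr_pwDl//.
  by have [_ [_]] := vP i; apply.
have Kp : simplex p by case: Zp.
have /simplexP[p_ge0 _] := Kp.
have := annihilator_span Zp Hv; rewrite functionalE => /psumr_eq0P.
move=> /(_ _ i isT)/eqP; rewrite mulf_eq0 (gt_eqF pi_gt0) orbF.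
move=> vi0; apply/eqP/vi0 => k _.
by rewrite summxE mulr_ge0.
Qed.

End Cone.

(** * Coordinate images of [H] and property (B) *)

Section CoordImage.
Context {R : realType} {n : nat} (H : set 'rV[R]_n).

Lemma coord_imageE l (i : 'I_l -> 'I_n) :
  coord_image i H = (colsub i : 'rV[R]_n -> 'rV[R]_l) @` H.
Proof.
by apply: eq_imagel => h _; apply/rowP => a; rewrite !mxE tauE.
Qed.

Lemma real_span_coord_image l (i : 'I_l -> 'I_n) :
  real_span (coord_image i H) =
  (colsub i : 'rV[R]_n -> 'rV[R]_l) @` real_span H.
Proof. by rewrite coord_imageE real_span_image. Qed.

Lemma coord_image_subgroup l (i : 'I_l -> 'I_n) :
  zmod_closed (mem H) -> zmod_closed (mem (coord_image i H)).
Proof.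
move=> H_subgroup; rewrite coord_imageE; split=> [|x y]; rewrite !inE.
  by exists 0; [exact: subgroup0|exact: linear0].
move=> [h Hh <-] [h' Hh' <-]; exists (h - h'); first exact: subgroupB.
exact: linearB.
Qed.

Lemma closure_coord_imageP l (i : 'I_l -> 'I_n) y :
  closure (coord_image i H) y <->
  forall e : R, 0 < e ->
    exists2 h, H h & forall a, `|y ord0 a - h ord0 (i a)| < e.
Proof.
rewrite coord_imageE; split=> [/closure_rowP yH e /yH[_ [h Hh <-] yh]|yH].
  by exists h => // a; have := yh a; rewrite mxE.
apply/closure_rowP => e /yH[h Hh yh].
by exists (colsub i h); [exists h|move=> a; rewrite mxE].
Qed.

Lemma property_B_dense_in (m l : nat) (i : 'I_l -> 'I_n) :
  zmod_closed (mem H) -> (forall a, face_support H (i a)) -> (1 < m)%N ->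
  property_B m H -> dense_in (coord_image i H) (real_span (coord_image i H)).
Proof.
move=> H_subgroup iS m_gt1 BH; split; first exact: sub_real_span.
have A_subgroup := coord_image_subgroup i H_subgroup.
apply: real_span_min; last exact: subset_closure.
apply: (closure_divisible_submod m_gt1 A_subgroup) => e e_gt0.
rewrite coord_imageE => _ [h Hh <-].
have /choice[p pP] : forall a, exists p, annihilator H p /\
    0 < p (delta_mx ord0 (i a)).
  by move=> a; have [p ? ?] := iS a; exists p.
(* A common lower bound for the chosen weights; the default value 1 covers [l = 0] and ensures
   [c <= 1]. *)
pose c := \big[Order.min/1]_a p a (delta_mx ord0 (i a)).
have c_gt0 : 0 < c by apply: lt_bigmin => // a _; have [] := pP a.
have c_le1 : c <= 1 by exact: bigmin_le_id.
have c_le a : c <= p a (delta_mx ord0 (i a)) by exact: bigmin_le.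
(* If all coordinates of [w] are at least [- (e * c / 2)], then [p a w = 0] bounds the weighted
   coordinate at [i a] by [e * c / 2], and dividing by a weight at least [c] leaves at most
   [e / 2]. *)
have ec_gt0 : 0 < e * c / 2 by rewrite divr_gt0// mulr_gt0.
have [h' Hh' hh'] := BH _ ec_gt0 _ Hh.
exists (colsub i h'); first by exists h'.
move=> a; rewrite !mxE.
pose w := h - m%:R *: h'.
have -> : h ord0 (i a) - m%:R * h' ord0 (i a) = w ord0 (i a) by rewrite !mxE.
have [Zp pa_gt0] := pP a.
have Kp : simplex (p a) by case: Zp.
have /simplexP[p_ge0 p1] := Kp.
have pw0 : \sum_k w ord0 k * p a (delta_mx ord0 k) = 0.
  rewrite -functionalE linearB linearZ /=.
  by case: Zp => _ pH; rewrite !pH// scaler0 subr0.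
have wa_le : w ord0 (i a) * p a (delta_mx ord0 (i a)) <= e * c / 2.
  move: pw0; rewrite (bigD1 (i a))//= => /eqP; rewrite addr_eq0 => /eqP->.
  have -> : e * c / 2 = \sum_k e * c / 2 * p a (delta_mx ord0 k).
    by rewrite -mulr_sumr p1 mulr1.
  rewrite -sumrN [leRHS](bigD1 (i a))//=.
  apply: ler_wpDl; first by apply: mulr_ge0 => //; exact: ltW.
  by apply: ler_sum => k _; rewrite -mulNr ler_wpM2r// lerNl hh'.
have wa_ge : - (e * c / 2) <= w ord0 (i a) by exact: hh'.
have ec : e * c <= e by rewrite ler_piMr// ltW.
rewrite ltr_norml; apply/andP; split; first by lra.
rewrite -(ltr_pM2r pa_gt0); apply: (le_lt_trans wa_le).
have : e * c <= e * p a (delta_mx ord0 (i a)) by rewrite ler_pM2l.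
have : 0 < e * c by rewrite mulr_gt0.
lra.
Qed.

(* Off the face, a large multiple of a strictly positive element of the span
   absorbs any error, and it can be taken near [H] by recurrence. *)
Lemma dense_in_property_B (m l : nat) (i : 'I_l -> 'I_n) :
  zmod_closed (mem H) -> (forall k, face_support H k -> exists a, i a = k) ->
  (0 < m)%N ->
  dense_in (coord_image i H) (real_span (coord_image i H)) -> property_B m H.
Proof.
move=> H_subgroup iS m_gt0 [_ A_dense] eps eps_gt0 h Hh.
have m0 : 0 < m%:R :> R by rewrite ltr0n.
(* On the face two errors below [d], from [h1] and [h2], are multiplied by [m], giving a total below
   [eps]. *)
pose d := eps / 2 / m%:R.
have d_gt0 : 0 < d by rewrite !divr_gt0.
have md : m%:R * d = eps / 2 by rewrite mulrC divfK// gt_eqF.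
pose x := m%:R^-1 *: h.
have hE k : h ord0 k = m%:R * x ord0 k by rewrite mxE mulVKf// gt_eqF.
have /A_dense/closure_coord_imageP/(_ _ d_gt0)[h1 Hh1 xh1] :
    real_span (coord_image i H) (colsub i x).
  rewrite real_span_coord_image; exists x => //.
  by apply: real_spanZ; exact: sub_real_span.
have [v Hv vP] := strict_complement H.
have v_ge0 k : 0 <= v ord0 k.
  have [v0 v_gt0] := vP k.
  by have [/v0->//|/v_gt0/ltW] := pselect (face_support H k).
(* Off the face, a multiple of [v] by at least [u k] outweighs the error of [h1] and the later error
   [d]. On the face [v ord0 k = 0], and division by zero makes [u k] zero. *)
pose u k := (`|h1 ord0 k - x ord0 k| + d) / v ord0 k.
have u_ge0 k : 0 <= u k by rewrite divr_ge0// addr_ge0// ltW.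
pose N0 := (Num.truncn (\sum_k u k)).+1.
have [N N0N [h2 Hh2 vh2]] := recurrence N0 H_subgroup Hv d_gt0.
exists (h1 - h2); first exact: subgroupB.
move=> k; rewrite !mxE hE.
have -> : m%:R * x ord0 k - m%:R * (h1 ord0 k - h2 ord0 k) =
          m%:R * (x ord0 k - h1 ord0 k + h2 ord0 k) by ring.
have [v0 v_gt0] := vP k; have := vh2 k.
have [Sk|/v_gt0 vk_gt0] := pselect (face_support H k).
  have [a ak] := iS _ Sk.
  have := xh1 a; rewrite mxE ak (v0 Sk) mulr0 !ltr_norml => ? ?.
  have -> : - eps = m%:R * (- (2 * d)) by rewrite mulrN mulrCA md; field.
  by rewrite ler_pM2l//; lra.
have : u k * v ord0 k <= N%:R * v ord0 k.
  rewrite ler_pM2r//; apply: (@le_trans _ _ (\sum_k u k)).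
    by rewrite (bigD1 k)//= lerDl sumr_ge0.
  by apply: (le_trans (ltW (truncnS_gt _))); rewrite ler_nat.
rewrite /u divfK ?gt_eqF// => uN.
rewrite ltr_norml => ?; apply: (@le_trans _ _ 0); first by lra.
apply: mulr_ge0; first exact: ltW.
have := ler_norm (h1 ord0 k - x ord0 k).
lra.
Qed.

(** * Maximal independent sets of vertices and transfer of density *)

(** A dual basis [e] is built in the span: if [e b] did not exist, coordinate [j b] would vanish
    wherever the other [j] coordinates do, hence be a combination of them, against independence. *)
Lemma coordinates_onto k (j : 'I_k -> 'I_n) :
  (forall c : 'I_k -> R,
     (forall x, real_span H x -> \sum_b c b * x ord0 (j b) = 0) ->
     forall b, c b = 0) ->
  forall y : 'rV[R]_k,
    exists2 x, real_span H x & forall b, x ord0 (j b) = y ord0 b.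
Proof.
move=> j_indep y.
have /choice[e eP] : forall b, exists x, real_span H x /\
    forall b', x ord0 (j b') = (b == b')%:R.
  move=> b; apply: contrapT => no_x.
  (* Replacing coordinate [j b] by zero keeps the index type while imposing only the other
     coordinates. *)
  pose f b' (x : 'rV[R]_n) := if b' == b then 0 else x ord0 (j b').
  have fL b' : scalar (f b').
    by move=> a u v; rewrite /f !mxE; case: ifP => // _; rewrite mulr0 addr0.
  have [x Hx fx|c cE] :=
      scalar_combination (real_span_submod H) fL (coord_scalar (j b)).
    apply: contrapT => /eqP xb0; apply: no_x; exists ((x ord0 (j b))^-1 *: x).
    split=> [|b']; first exact: real_spanZ.
    rewrite mxE; have := fx b'; rewrite /f eq_sym.
    by have [->|_ ->] := eqVneq b' b; rewrite ?mulr0// mulVf.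
  pose d b' := if b' == b then 1 else - c b'.
  have /j_indep/(_ b)/eqP :
      forall x, real_span H x -> \sum_b' d b' * x ord0 (j b') = 0.
    move=> x Hx; rewrite /d.
    rewrite (bigD1 b)//= eqxx mul1r cE// (bigD1 b)//= /f eqxx mulr0 add0r.
    by rewrite -big_split big1//= => b' /negPf->; rewrite mulNr subrr.
  by rewrite /d eqxx oner_eq0.
exists (\sum_b y ord0 b *: e b) => [|b].
  by apply: real_span_sum => b _; apply: real_spanZ; have [] := eP b.
rewrite summxE (bigD1 b)//= mxE (eP b).2 eqxx mulr1 big1 ?addr0// => b' b'b.
by rewrite mxE (eP b').2 (negPf b'b) mulr0.
Qed.

(** Maximality is restated for the family [j]. For a vertex outside the set, adjoining it creates a
    linear relation, which can be solved for the new coordinate. *)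
Lemma maximal_indep_vertices k (j : 'I_k -> 'I_n) (j_inj : injective j) :
  maxset (fun J : {set 'I_n} => `[< indep_vertices H J >])
    [set j b | b : 'I_k]%SET ->
  [/\ forall b, face_support H (j b),
      forall c : 'I_k -> R,
        (forall x, real_span H x -> \sum_b c b * x ord0 (j b) = 0) ->
        forall b, c b = 0 &
      forall i, face_support H i -> exists c : 'I_k -> R,
        forall x, real_span H x -> x ord0 i = \sum_b c b * x ord0 (j b)].
Proof.
set J := [set j b | b : 'I_k]%SET.
move=> /maxsetP[/asboolP[J_vert J_indep] J_max].
have Jj b : j b \in J by apply: imset_f.
have sumJ (c : 'I_n -> R) (x : 'rV[R]_n) : \sum_(i in J) c i * tau i x =
    \sum_b c (j b) * x ord0 (j b).
  rewrite big_imset /=; last by move=> ? ? _ _; apply: j_inj.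
  by apply: eq_bigr => b _; rewrite tauE.
split=> [b|c c0 b|i Si].
- exact/min_face_vertexP/J_vert.
(* Coefficients indexed by [b] become coefficients on indices of vertices; by injectivity of [j]
   each sum over a fibre in the image has one term. *)
- pose c' i := \sum_(b | j b == i) c b.
  have c'j b' : c' (j b') = c b'.
    by rewrite /c' (eq_bigl (pred1 b')) ?big_pred1_eq// => a; apply: inj_eq.
  rewrite -c'j; apply: J_indep => // x Hx; rewrite sumJ -[RHS](c0 x Hx).
  by apply: eq_bigr => b' _; rewrite c'j.
have [|iJ] := boolP (i \in J).
  move=> /imsetP[b _ ->]; exists (fun b' => (b' == b)%:R) => x _.
  rewrite (bigD1 b)//= eqxx mul1r big1 ?addr0// => b' /negPf->.
  by rewrite mul0r.
have : ~ indep_on (real_span H) (i |: J).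
  move=> iJ_indep; have iJE : i |: J = J.
    apply: J_max; last exact: finset.subsetUr.
    apply/asboolP; split=> // k0; rewrite in_setU1 => /predU1P[->|].
      exact/min_face_vertexP.
    exact: J_vert.
  by move: iJ; rewrite -iJE finset.setU11.
move=> /existsNP[c /not_implyP[c0 /existsNP[i0 /not_implyP[i0iJ ci0]]]].
have {}c0 x : real_span H x ->
    c i * x ord0 i + \sum_b c (j b) * x ord0 (j b) = 0.
  by move=> /c0; rewrite big_setU1//= sumJ tauE.
(* Otherwise the relation would live on [J] alone and be trivial. *)
have ci : c i != 0.
  apply/eqP => ci; apply: ci0.
  move: i0iJ; rewrite in_setU1 => /predU1P[->//|]; apply: J_indep => x /c0.
  by rewrite ci mul0r add0r sumJ.
exists (fun b => - (c i)^-1 * c (j b)) => x /c0/eqP.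
rewrite addr_eq0 => /eqP cix; apply: (mulfI ci); rewrite cix mulr_sumr -sumrN.
by apply: eq_bigr => b _; rewrite !mulrA mulrN divff// mulN1r mulNr.
Qed.

(** A target [y] lifts to [x] in the span of [H]; approximating [x] on the coordinates [i]
    approximates [y], since they include the coordinates [j]. *)
Lemma dense_in_dense l (i : 'I_l -> 'I_n) k (j : 'I_k -> 'I_n) :
  (forall b, exists a, i a = j b) ->
  (forall y : 'rV[R]_k,
     exists2 x, real_span H x & forall b, x ord0 (j b) = y ord0 b) ->
  dense_in (coord_image i H) (real_span (coord_image i H)) ->
  dense (coord_image j H).
Proof.
move=> ij j_onto [_ A_dense]; apply/dense_closureP => y.
have [x Hx xy] := j_onto y; apply/closure_coord_imageP => e e_gt0.
have /A_dense/closure_coord_imageP/(_ _ e_gt0)[h Hh xh] :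
    real_span (coord_image i H) (colsub i x).
  by rewrite real_span_coord_image; exists x.
exists h => // b; have [a ab] := ij b.
by have := xh a; rewrite mxE ab xy.
Qed.

(** On the span the coordinates [i] are fixed linear combinations of the coordinates [j], so
    approximation errors grow by a factor less than [C]. *)
Lemma dense_dense_in l (i : 'I_l -> 'I_n) k (j : 'I_k -> 'I_n) :
  (forall a, exists c : 'I_k -> R,
     forall x, real_span H x -> x ord0 (i a) = \sum_b c b * x ord0 (j b)) ->
  dense (coord_image j H) ->
  dense_in (coord_image i H) (real_span (coord_image i H)).
Proof.
move=> /choice[c cE] /dense_closureP A_dense.
split; first exact: sub_real_span.
rewrite real_span_coord_image => _ [x Hx <-].
apply/closure_coord_imageP => e e_gt0.
pose C := 1 + \sum_a \sum_b `|c a b|.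
have C_gt0 : 0 < C by rewrite ltr_pwDl// !sumr_ge0// => a _; rewrite sumr_ge0.
have /closure_coord_imageP/(_ _ (divr_gt0 e_gt0 C_gt0))[h Hh xh] :=
  A_dense (colsub j x).
exists h => // a; rewrite mxE !cE//; last exact: sub_real_span.
rewrite -sumrB; apply: (le_lt_trans (ler_norm_sum _ _ _)).
apply: (@le_lt_trans _ _ (\sum_b `|c a b| * (e / C))).
  apply: ler_sum => b _; rewrite -mulrBr normrM ler_wpM2l// ltW//.
  by have := xh b; rewrite mxE.
rewrite -mulr_suml mulrA ltr_pdivrMr// mulrC ltr_pM2l//.
rewrite /C ltr_pwDl// (bigD1 a)//= lerDl sumr_ge0// => a' _.
by rewrite sumr_ge0.
Qed.

End CoordImage.

(** * The cycle of implications *)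

Theorem theorem9p1 (R : realType) (n : nat) (H : set 'rV[R]_n)
  (H_subgroup : zmod_closed (mem H))
  (l : nat) (i : 'I_l -> 'I_n) (i_inj : injective i)
  (i_vertices : range (fun a => tau (i a)) = vertices (min_face H))
  (k : nat) (j : 'I_k -> 'I_n) (j_inj : injective j)
  (j_max : maxset (fun J : {set 'I_n} => `[< indep_vertices H J >])
             [set j b | b : 'I_k]%SET)
  (m : nat) (m_gt1 : (1 < m)%N) :
  [<-> property_B 2 H;
       property_B m H;
       dense_in (coord_image i H) (real_span (coord_image i H));
       dense (coord_image j H)].
Proof.
have iS a : face_support H (i a).
  by apply/min_face_vertexP; rewrite -i_vertices; exists a.
have Si k0 : face_support H k0 -> exists a, i a = k0.
  move=> /min_face_vertexP; rewrite -i_vertices => -[a _ tau_eq]; exists a.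
  have := congr1 (fun f : functional R n => f (delta_mx ord0 k0)) tau_eq.
  rewrite /= !tau_delta eqxx; case: (i a =P k0) => // _ /eqP.
  by rewrite eq_sym oner_eq0.
have [jS j_indep j_comb] := maximal_indep_vertices j_inj j_max.
have B_dense m0 : (1 < m0)%N -> property_B m0 H ->
    dense_in (coord_image i H) (real_span (coord_image i H)).
  exact: property_B_dense_in.
have dense_B m0 : (0 < m0)%N ->
    dense_in (coord_image i H) (real_span (coord_image i H)) ->
    property_B m0 H.
  exact: dense_in_property_B.
tfae.
(* The passage from 2 to [m] goes through density, which does not mention the multiplier. *)
- by move=> /B_dense-/(_ isT)/dense_B; apply; apply: ltnW.
- exact: B_dense.
- by apply: dense_in_dense => [b|]; [exact/Si/jS|exact: coordinates_onto].
- move=> j_dense; apply: dense_B => //; apply: dense_dense_in j_dense => a.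
  exact/j_comb/iS.
Qed.
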